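(* Let $X$ be a Banach lattice and let $x\in B_X$ be a strongly extreme point of $B_X$. If the identity can be approximated by finite rank lattice projections at $x$, then $x$ is a denting point of $B_X$.
   Context: $B_X$ is the closed unit ball and $S_X$ the unit sphere of $X$. A point $x\in S_X$ is a strongly extreme point (of $B_X$) if for every sequence $(x_n)$ in $X$ with $\|x+x_n\|\to1$ and $\|x-x_n\|\to1$ one has $\|x_n\|\to0$ (strongly extreme points of $B_X$ lie in $S_X$). A projection $P:X\to X$ on a Banach lattice $X$ is a lattice projection if $u$ and $v$ are disjoint (i.e. $|u|\wedge|v|=0$) whenever $u\in P(X)$ and $v\in\ker P$. The identity can be approximated by finite rank lattice projections at a point $x\in X$ if for every $\varepsilon>0$ there exists a lattice projection $P$ of finite rank with $\|x-Px\|<\varepsilon$. A point $x\in B_X$ is a denting point of $B_X$ if for every $\varepsilon>0$ there is a slice of $B_X$, i.e. a set $\{y\in B_X:x^*(y)>1-\alpha\}$ with $x^*\in S_{X^*}$ and $\alpha>0$, which contains $x$ and has diameter less than $\varepsilon$. *)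

(* Defs.v *)
From HB Require Import structures.
From mathcomp Require Import all_boot all_order all_algebra.
From mathcomp Require Import all_classical all_reals all_analysis.

Set Implicit Arguments.
Unset Strict Implicit.
Unset Printing Implicit Defensive.

Import Order.TTheory GRing.Theory Num.Theory.
Import numFieldNormedType.Exports.

Local Open Scope classical_set_scope.
Local Open Scope ring_scope.

(* The lattice order is carried by its own mixin: [Order.Lattice] cannot be
   joined with the normed-module hierarchy, because [Num.NumDomain] already
   inherits from orders and norms without an intermediate join.  The lattice
   axioms have the same shape as those of [Order.POrder_isMeetSemilattice] and
   [Order.POrder_isJoinSemilattice].  The notation [`|x|] is always the
   real-valued norm; the modulus of [x], which is a vector, is [modulus x]. *)

HB.mixin Record isVectorLattice (R : realType) X & GRing.Lmodule R X := {
  vle : rel X ;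
  vmeet : X -> X -> X ;
  vjoin : X -> X -> X ;
  vle_refl : reflexive vle ;
  vle_anti : antisymmetric vle ;
  vle_trans : transitive vle ;
  vlexI : forall x y z : X, vle x (vmeet y z) = vle x y && vle x z ;
  vleUx : forall x y z : X, vle (vjoin x y) z = vle x z && vle y z ;
  vleD2r : forall z x y : X, vle x y -> vle (x + z) (y + z) ;
  vleZ : forall (a : R) (x y : X), 0 <= a -> vle x y -> vle (a *: x) (a *: y)
}.

#[short(type="vectorLatticeType")]
HB.structure Definition VectorLattice (R : realType) :=
  {X of GRing.Lmodule R X & isVectorLattice R X}.

Definition modulus (R : realType) (X : vectorLatticeType R) (x : X) : X :=
  vjoin x (- x).

Definition disjoint_vec (R : realType) (X : vectorLatticeType R) (u v : X) :=
  vmeet (modulus u) (modulus v) = 0.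

HB.mixin Record isBanachLattice (R : realType) X
    & CompleteNormedModule R X & VectorLattice R X := {
  vle_norm : forall x y : X, vle (modulus x) (modulus y) -> `|x| <= `|y|
}.

#[short(type="banachLatticeType")]
HB.structure Definition BanachLattice (R : realType) :=
  {X of CompleteNormedModule R X & VectorLattice R X & isBanachLattice R X}.

Section Normed.
Variables (R : realType) (X : normedModType R).

Definition unit_ball : set X := [set y | `|y| <= 1].

Definition unit_sphere : set X := [set y | `|y| = 1].

Definition strongly_extreme (x : X) :=
  unit_sphere x /\
  forall u : nat -> X,
    `|x + u n| @[n --> \oo] --> (1 : R) ->
    `|x - u n| @[n --> \oo] --> (1 : R) ->
    `|u n| @[n --> \oo] --> (0 : R).

Definition dual_norm (f : X -> R) : \bar R :=
  ereal_sup [set `|f y|%:E | y in unit_ball].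

Definition dual_sphere : set {linear X -> R^o} :=
  [set f | continuous f /\ dual_norm f = 1%:E].

Definition slice (f : X -> R) (alpha : R) : set X :=
  [set y | unit_ball y /\ f y > 1 - alpha].

Definition diam (A : set X) : \bar R :=
  ereal_sup [set `|p.1 - p.2|%:E | p in A `*` A].

Definition denting (x : X) :=
  unit_ball x /\
  forall eps : R, 0 < eps ->
    exists (f : {linear X -> R^o}) (alpha : R),
      [/\ dual_sphere f, 0 < alpha, slice f alpha x &
          (diam (slice f alpha) < eps%:E)%E].

Definition projection (P : {linear X -> X}) :=
  continuous P /\ forall y, P (P y) = P y.

Definition finite_rank (P : {linear X -> X}) :=
  exists (n : nat) (e : 'I_n -> X),
    forall y, exists c : 'I_n -> R, P y = \sum_(i < n) c i *: e i.

End Normed.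

Definition lattice_projection (R : realType) (X : banachLatticeType R)
    (P : {linear X -> X}) :=
  projection P /\
  forall u v, range P u -> P v = 0 -> disjoint_vec u v.

Definition id_approx_at (R : realType) (X : banachLatticeType R) (x : X) :=
  forall eps : R, 0 < eps ->
    exists P : {linear X -> X},
      [/\ lattice_projection P, finite_rank P & `|x - P x| < eps].

(* Main.v *)
From HB Require Import structures.
Require Import Defs.
From mathcomp Require Import all_boot all_order all_algebra.
From mathcomp Require Import all_classical all_reals all_analysis.
From mathcomp Require Import lra.

(** Fix [e > 0] and let [P] be a finite rank lattice projection with [P x]
close to [x].  If [y] is in the unit ball and [P y] is close to [P x], put
[u = y - P y].  The vectors [P y] and [u] are disjoint, so that [P y - u] and
[P y + u = y] have the same modulus and [`|P y - u| <= 1]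
([norm_disjointB]).  Hence [x + u] and [x - u], being close to [y] and to
[P y - u], have norm at most [1 + d] for a small [d], and strong extremality
makes [u] small.  Then [y] is close to [P y], hence to [x]
([lattice_projection_continuity]).  As [P] has finite rank, the condition that
[P y] be close to [P x] follows from finitely many inequalities
[h i (y - x) < rho] with bounded functionals [h i] ([finite_rank_weak_nbhd]):
[x] is a point of weak-to-norm continuity of the unit ball.

It remains to replace the weak neighbourhood by a slice
([slice_in_weak_nbhd]).  The points of the ball outside the neighbourhood lie in
finitely many convex sets [D i = {y | `|y| <= 1, rho <= h i (y - x)}], each at
positive distance from [x].  The convex hull of their union is also at positive
distance from [x]: a convex combination of points of the [D i], one for each
[i], has one coefficient bounded below by a constant [th] that only depends on
the number of sets, and if an average of points of the ball is close to [x],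
each point whose weight is at least [th] is close to [x]
([strongly_extreme_average]).  A Hahn-Banach separation ([cone_separation]) then
gives a functional [f] with [f y <= f x - eta] outside the neighbourhood; after
normalization it defines a slice around [x] of small diameter
([denting_of_weak_nbhd]).

The Hahn-Banach theorem is used in the form [hahn_banach_cone], where a convex
cone in [X * R] plays the part of the epigraph of a sublinear functional. *)

Set Implicit Arguments.
Unset Strict Implicit.
Unset Printing Implicit Defensive.

Import Order.TTheory GRing.Theory Num.Theory.
Import numFieldNormedType.Exports.

Local Open Scope classical_set_scope.
Local Open Scope ring_scope.

(** * The Hahn-Banach theorem for convex cones *)

Section HahnBanach.
Variables (R : realType) (X : lmodType R).
Implicit Types (C E : set (X * R)) (u v w : X) (r s t a : R).

(** Convex cones with apex at the origin of [X * R]. *)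
Definition convex_cone C :=
  [/\ C (0, 0),
      forall u v r s, C (u, r) -> C (v, s) -> C (u + v, r + s) &
      forall a u r, 0 <= a -> C (u, r) -> C (a *: u, a * r)].

(** The cone contains no vertical ray pointing downwards. *)
Definition proper_cone C := forall r, C (0, r) -> 0 <= r.

(** The sum of [C] and of the ray spanned by [(w, c)]. *)
Definition add_ray C w c : set (X * R) :=
  [set p | exists u r t, [/\ C (u, r), 0 <= t & p = (u + t *: w, r + t * c)]].

Lemma add_ray_cone C w c : convex_cone C -> convex_cone (add_ray C w c).
Proof.
case=> C0 CD CZ; split.
- by exists 0, 0, 0; split => //; rewrite scale0r mul0r !addr0.
- move=> _ _ _ _ [u [r [t [Cu t0 [-> ->]]]]] [v [s [t' [Cv t'0 [-> ->]]]]].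
  exists (u + v), (r + s), (t + t'); split; [exact: CD|exact: addr_ge0|].
  by rewrite scalerDl mulrDl addrACA [X in (_, X)]addrACA.
- move=> a _ _ a0 [u [r [t [Cu t0 [-> ->]]]]].
  exists (a *: u), (a * r), (a * t); split; [exact: CZ|exact: mulr_ge0|].
  by rewrite scalerDr scalerA mulrDr mulrA.
Qed.

Lemma maximal_proper_cone E0 : convex_cone E0 -> proper_cone E0 ->
  exists E, [/\ E0 `<=` E, convex_cone E, proper_cone E &
    forall E', E `<=` E' -> convex_cone E' -> proper_cone E' -> E' `<=` E].
Proof.
move=> cE0 pE0.
pose P : set (set (X * R)) :=
  fun A => convex_cone (A `|` E0) /\ proper_cone (A `|` E0).
have [F FP Ftot|A [[cA pA] Amax]] := @Zorn_bigcup (X * R)%type P; last first.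
  exists (A `|` E0); split => //.
  move=> E' AE' cE' pE'; apply: contrapT => nE'.
  have EE0 : E' `|` E0 = E'.
    by apply/setUidl; apply: subset_trans AE'; exact: subsetUr.
  apply: (Amax E'); last by split; rewrite EE0.
  rewrite properEneq; split; last by apply: subset_trans AE'; exact: subsetUl.
  by apply/eqP => AE; apply: nE'; rewrite -AE; exact: subsetUl.
(* Two elements of the union of the chain [F] with [E0] lie in [A `|` E0] for a
   common member [A] of [F], or in [E0]; the chain may be empty. *)
have common p q : (\bigcup_(A in F) A `|` E0) p ->
    (\bigcup_(A in F) A `|` E0) q ->
    exists E, [/\ E `<=` \bigcup_(A in F) A `|` E0, convex_cone E, E p & E q].
  have mem A : F A -> A `|` E0 `<=` \bigcup_(A in F) A `|` E0.
    by move=> FA; apply: setSU => z Az; exists A.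
  move=> [[A FA Ap]|E0p] [[B FB Bq]|E0q].
  - have [AB|BA] := Ftot _ _ FA FB.
    + by exists (B `|` E0); split;
        [exact: mem|exact: (FP _ FB).1|left; exact: AB|left].
    + by exists (A `|` E0); split;
        [exact: mem|exact: (FP _ FA).1|left|left; exact: BA].
  - by exists (A `|` E0); split; [exact: mem|exact: (FP _ FA).1|left|right].
  - by exists (B `|` E0); split; [exact: mem|exact: (FP _ FB).1|right|left].
  - by exists E0; split => //; exact: subsetUr.
split; first split.
- by right; case: cE0.
- move=> u v r s /common h /h[E [sE [_ ED _] Eu Ev]].
  by apply: sE; exact: ED.
- move=> a u r a0 Hu; have [E [sE [_ _ EZ] Eu _]] := common _ _ Hu Hu.
  by apply: sE; exact: EZ.
- move=> r [[A FA Ar]|]; last exact: pE0.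
  by apply: (FP _ FA).2; left.
Qed.

(** A proper convex cone that projects onto [X] lies above the graph of a linear
functional.  A maximal proper cone [E] containing [E0] is the epigraph of that
functional. *)
Theorem hahn_banach_cone E0 : convex_cone E0 -> proper_cone E0 ->
  (forall v, exists r, E0 (v, r)) ->
  exists f : {linear X -> R^o}, forall v r, E0 (v, r) -> f v <= r.
Proof.
move=> cE0 pE0 E0tot.
have [E [sE cE pE Emax]] := maximal_proper_cone cE0 pE0.
have [Ez ED EZ] := cE.
have Etot v : exists r, E (v, r) by have [r /sE] := E0tot v; exists r.
(* By maximality, [E] contains every ray whose addition keeps it proper. *)
have Eadd w c : (forall u r t, E (u, r) -> 0 < t -> u + t *: w = 0 ->
    0 <= r + t * c) -> E (w, c).
  move=> H; apply: (Emax (add_ray E w c)).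
  - move=> [u r] Eu; exists u, r, 0.
    by rewrite scale0r mul0r !addr0.
  - exact: add_ray_cone.
  - move=> _ [u [r [t [Eu t0 [/esym ut ->]]]]].
    move: t0; rewrite le_eqVlt => /predU1P[t0|t0]; last exact: H ut.
    move: ut; rewrite -t0 scale0r mul0r !addr0 => u0.
    by apply: pE; rewrite -u0.
  - by exists 0, 0, 1; rewrite scale1r mul1r !add0r.
have Ele u r s : E (u, r) -> E (- u, s) -> - s <= r.
  move=> Eu Ev; rewrite -subr_ge0 opprK; apply: pE.
  by rewrite -(subrr u); exact: ED.
(* [G] is the lineality space of [E], and is shown to be the graph of a linear
   function. *)
pose G v a := E (v, a) /\ E (- v, - a).
have Gtot w : exists a, G w a.
  have [r0 Er0] := Etot w; have [s0 Es0] := Etot (- w).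
  (* The witness is the infimum of the values lying above [w] in [E]. *)
  pose S := [set r | E (w, r)].
  have S0 : S !=set0 by exists r0.
  have Slb : has_lbound S by exists (- s0) => r Er; exact: Ele Er Es0.
  exists (inf S); split; apply: Eadd => u r t Eu t0 /eqP.
  - rewrite addr_eq0 => /eqP uE.
    have : - (t^-1 * r) <= inf S.
      apply: lb_le_inf => // q Eq; apply: Ele Eq _.
      suff -> : - w = t^-1 *: u by apply: EZ => //; rewrite invr_ge0 ltW.
      by rewrite uE scalerN scalerA mulVf ?gt_eqF// scale1r.
    rewrite -(ler_pM2l t0) mulrN mulrA divff ?gt_eqF// mul1r; lra.
  - rewrite scalerN subr_eq0 => /eqP uE.
    have : inf S <= t^-1 * r.
      apply: ge_inf => //; rewrite /S /=.
      suff -> : w = t^-1 *: u by apply: EZ => //; rewrite invr_ge0 ltW.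
      by rewrite uE scalerA mulVf ?gt_eqF// scale1r.
    rewrite -(ler_pM2l t0) mulrA divff ?gt_eqF// mul1r; lra.
have Gfun v a b : G v a -> G v b -> a = b.
  move=> [Ea Ea'] [Eb Eb']; apply/eqP; rewrite eq_le.
  by move: (Ele _ _ _ Ea Eb') (Ele _ _ _ Eb Ea'); rewrite !opprK => -> ->.
pose f v := projT1 (cid (Gtot v)).
have fG v : G v (f v) by rewrite /f; case: cid.
have GZ k v a : G v a -> G (k *: v) (k * a).
  move=> [Ea Ea']; have [k0|/ltW k0] := leP 0 k.
    by split; [exact: EZ|rewrite -scalerN -mulrN; exact: EZ].
  rewrite -oppr_ge0 in k0.
  split; last by rewrite -scaleNr -mulNr; exact: EZ.
  by rewrite -[k]opprK scaleNr mulNr -scalerN -mulrN; exact: EZ.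
have GD u v a b : G u a -> G v b -> G (u + v) (a + b).
  move=> [Ea Ea'] [Eb Eb']; split; first exact: ED.
  by rewrite !opprD; exact: ED.
have flin : linear (f : X -> R^o).
  move=> k u v; apply: Gfun (fG _) _.
  by apply: GD => //; exact: GZ.
pose F : {linear X -> R^o} :=
  HB.pack f (GRing.isLinear.Build R X R^o _ (f : X -> R^o) flin).
exists F => v r /sE Ev; have [_ Ef] := fG v.
by have := Ele _ _ _ Ev Ef; rewrite opprK.
Qed.

End HahnBanach.

(** * Bounded functionals on a normed space *)

Section Functionals.
Variables (R : realType) (X : normedModType R).
Implicit Types (u v w : X) (r s t : R).

(** Applied to the cone generated by the pairs [(x - y, eta)], [y] in a convex
set [D] at distance at least [eta] from [x], this gives a functional [f] with
[f y <= f x - eta] on [D]. *)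
Theorem cone_separation (C : set (X * R)) : convex_cone C ->
  (forall u r, C (u, r) -> r <= `|u|) ->
  exists f : {linear X -> R^o},
    (forall v, f v <= `|v|) /\ forall u r, C (u, r) -> r <= f u.
Proof.
move=> [C0 CD CZ] Cle.
(* The epigraph of the infimum over [(u, r)] in [C] of [`|v + u| - r]. *)
pose E0 : set (X * R) :=
  [set p | exists u r, C (u, r) /\ `|p.1 + u| - r <= p.2].
have [||v|f fE] := @hahn_banach_cone R X E0.
- split.
  + by exists 0, 0; split => //=; rewrite addr0 normr0 subr0.
  + move=> u v r s [u' [r' [Cu /= le1]]] [v' [s' [Cv /= le2]]].
    exists (u' + v'), (r' + s'); split; first exact: CD.
    rewrite /= addrACA; have := ler_normD (u + u') (v + v'); lra.
  + move=> a u r a0 [u' [r' [Cu /= le1]]].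
    exists (a *: u'), (a * r'); split; first exact: CZ.
    by rewrite /= -scalerDr normrZ ger0_norm// -mulrBr ler_wpM2l.
- by move=> r [u [s [/Cle le1 /=]]]; rewrite add0r; lra.
- by exists `|v|, 0, 0; split => //=; rewrite addr0 subr0.
exists f; split => [v|u r Cu].
  by apply: fE; exists 0, 0; split => //=; rewrite addr0 subr0.
have : f (- u) <= - r.
  by apply: fE; exists u, r; split => //=; rewrite addNr normr0 sub0r.
by rewrite linearN/=; lra.
Qed.

Lemma abs_functional_le (f : {linear X -> R^o}) :
  (forall v, f v <= `|v|) -> forall v, `|f v : R| <= `|v|.
Proof.
move=> fle v; rewrite ler_norml fle andbT.
by have := fle (- v); rewrite linearN/= normrN; lra.
Qed.

Lemma bounded_functional_continuous (f : {linear X -> R^o}) M :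
  (forall v, `|f v : R| <= M * `|v|) -> continuous f.
Proof.
move=> fM; apply: bounded_linear_continuous; apply/bounded_funP => r.
exists (`|M| * r) => v vr; apply: le_trans (fM v) _.
apply: (@le_trans _ _ (`|M| * `|v|)); first by rewrite ler_wpM2r// ler_norm.
by rewrite ler_wpM2l.
Qed.

Lemma continuous_bound (P : {linear X -> X}) : continuous P ->
  exists2 M, 0 < M & forall v, `|P v| <= M * `|v|.
Proof.
move=> /linear_bounded_continuous/linear_boundedP/pinfty_ex_gt0[M M0 PM].
by exists M.
Qed.

Lemma unit_functional w : w != 0 ->
  exists f : {linear X -> R^o},
    f w = 1 /\ exists M, forall v, `|f v : R| <= M * `|v|.
Proof.
move=> w0; have nw : 0 < `|w| by rewrite normr_gt0.
pose C : set (X * R) :=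
  [set p | exists t, 0 <= t /\ p = (t *: w, t * `|w|)].
have [||f [fle fC]] := @cone_separation C.
- split.
  + by exists 0; rewrite scale0r mul0r.
  + move=> _ _ _ _ [t [t0 [-> ->]]] [s [s0 [-> ->]]].
    by exists (t + s); rewrite addr_ge0// scalerDl mulrDl.
  + move=> a _ _ a0 [t [t0 [-> ->]]].
    by exists (a * t); rewrite mulr_ge0// scalerA mulrA.
- by move=> _ _ [t [t0 [-> ->]]]; rewrite normrZ ger0_norm.
have fw : f w = `|w|.
  apply/eqP; rewrite eq_le fle/=; apply: fC.
  by exists 1; rewrite scale1r mul1r.
exists (`|w|^-1 \*: f); split.
  by rewrite /= fw; apply: mulVf; rewrite gt_eqF.
exists (`|w|^-1) => v; rewrite /= normrM ger0_norm ?invr_ge0//.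
by rewrite ler_wpM2l ?invr_ge0//; exact: abs_functional_le.
Qed.

(** A finite system of bounded functionals and vectors that reproduces every
vector of the span of the [e i].  Each pair of [s] consists of a functional
and a vector. *)
Lemma span_coordinates n (e : 'I_n -> X) :
  exists s : seq ({linear X -> R^o} * X),
    (forall p, p \in s -> exists M, forall v, `|p.1 v : R| <= M * `|v|) /\
    forall c : 'I_n -> R, let v := \sum_(i < n) c i *: e i in
      v = \sum_(p <- s) p.1 v *: p.2.
Proof.
suff [s [sb se]] : exists s : seq ({linear X -> R^o} * X),
    (forall p, p \in s -> exists M, forall v, `|p.1 v : R| <= M * `|v|) /\
    forall i, e i = \sum_(p <- s) p.1 (e i) *: p.2.
  exists s; split => // c /=.
  under [RHS]eq_bigr do rewrite linear_sum scaler_suml.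
  rewrite exchange_big/=; apply: eq_bigr => i _.
  rewrite {1}(se i) scaler_sumr; apply: eq_bigr => p _.
  by rewrite scalerA linearZ.
elim: n e => [|n IH] e; first by exists [::]; split => // -[].
have [s [sb se]] := IH (fun i => e (widen_ord (leqnSn n) i)).
(* One new pair is needed when the last vector is not fixed by the reproducing
   operator [Q] of the previous ones. *)
pose Q v := \sum_(p <- s) p.1 v *: p.2.
have Qlin : linear Q.
  move=> k u v; rewrite /Q scaler_sumr -big_split/=; apply: eq_bigr => p _.
  by rewrite linearP scalerDl scalerA.
have Qb : exists M, forall v, `|Q v| <= M * `|v|.
  rewrite /Q; elim: s sb {se Q Qlin} => [|p s IHs] sb.
    by exists 0 => v; rewrite big_nil normr0 mul0r.
  have [|M HM] := IHs; first by move=> q qs; apply: sb; rewrite inE qs orbT.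
  have [N HN] := sb p (mem_head _ _).
  exists (N * `|p.2| + M) => v; rewrite big_cons mulrDl.
  apply: le_trans (ler_normD _ _) _; apply: lerD => //.
  by rewrite normrZ mulrAC ler_wpM2r.
pose w := e ord_max - Q (e ord_max).
have [w0|w0] := eqVneq w 0.
  exists s; split => // i; case: (unliftP ord_max i) => [j ->|->].
    have -> : lift ord_max j = widen_ord (leqnSn n) j.
      by apply: val_inj; rewrite /= /bump leqNgt ltn_ord.
    exact: se.
  by apply/eqP; rewrite -subr_eq0; apply/eqP.
have [g [gw [M HM]]] := unit_functional w0.
have glin : linear ((fun v => g (v - Q v)) : X -> R^o).
  move=> k u v; rewrite Qlin -linearP; congr (g _).
  by rewrite scalerBr opprD addrACA.
pose G : {linear X -> R^o} := HB.pack (fun v => g (v - Q v) : R^o)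
  (GRing.isLinear.Build R X R^o _ _ glin).
exists ((G, w) :: s); split.
  move=> p; rewrite inE => /predU1P[->|]; last exact: sb.
  have [N HN] := Qb; exists (`|M| * (1 + N)) => v /=.
  apply: le_trans (HM _) _.
  apply: (@le_trans _ _ (`|M| * `|v - Q v|)).
    by rewrite ler_wpM2r// ler_norm.
  rewrite -mulrA ler_wpM2l//; apply: le_trans (ler_normB _ _) _.
  by rewrite mulrDl mul1r lerD2l.
move=> i; rewrite big_cons/= -/(Q (e i)).
case: (unliftP ord_max i) => [j ->|->].
  have -> : lift ord_max j = widen_ord (leqnSn n) j.
    by apply: val_inj; rewrite /= /bump leqNgt ltn_ord.
  by rewrite /Q -se subrr linear0 scale0r add0r.
by rewrite -/w gw scale1r /w subrK.
Qed.

End Functionals.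

(** * Quantitative strong extremality *)

Section StronglyExtreme.
Variables (R : realType) (X : normedModType R).
Implicit Types (u v w y : X) (r s t : R).

(** Strong extremality in [e]-[d] form. *)
Lemma strongly_extreme_modulus x : strongly_extreme x ->
  forall e : R, 0 < e -> exists d, 0 < d /\
    forall u, `|x + u| <= 1 + d -> `|x - u| <= 1 + d -> `|u| < e.
Proof.
move=> [x1 xse] e e0; apply: contrapT => /forallNP nd.
have /choice[u hu] : forall n : nat, exists u,
    [/\ `|x + u| <= 1 + n.+1%:R^-1, `|x - u| <= 1 + n.+1%:R^-1 & e <= `|u|].
  move=> n; have := nd (n.+1%:R^-1); rewrite invr_gt0 ltr0Sn.
  move=> /not_andP[//|/existsNP[u /not_implyP[h1 /not_implyP[h2 h3]]]].
  by exists u; split => //; rewrite leNgt; apply/negP.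
have cvg1 (v : nat -> X) : (forall n, `|x + v n| <= 1 + n.+1%:R^-1) ->
    (forall n, `|x - v n| <= 1 + n.+1%:R^-1) ->
    `|x + v n| @[n --> \oo] --> (1 : R).
  move=> h1 h2; apply/cvgrPdist_lt => d d0.
  near=> n.
  have nd' : n.+1%:R^-1 < d.
    near: n; exact: (near_infty_natSinv_lt (PosNum d0)).
  have : 2 <= `|x + v n| + `|x - v n|.
    apply: le_trans (ler_normD _ _); rewrite addrACA subrr addr0.
    by rewrite -mulr2n normrMn x1.
  have arith (A B q : R) : A <= 1 + q -> B <= 1 + q -> q < d -> 2 <= A + B ->
    - d < 1 - A < d by move=> *; apply/andP; split; lra.
  by move/(arith _ _ _ (h1 n) (h2 n) nd') => h; rewrite ltr_norml; exact: h.
have /cvgrPdist_lt/(_ _ e0)[N _ /(_ N (leqnn N))] :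
    `|u n| @[n --> \oo] --> (0 : R).
  apply: xse; apply: cvg1 => n; have [h1 h2 h3] := hu n => //.
  by rewrite opprK.
rewrite sub0r normrN normr_id ltNge; case: (hu N) => _ _ ->.
by [].
Unshelve. all: by end_near. Qed.

(** If [x] is close to an average of two points of the unit ball, then [x] is
close to each of them whose weight is at least [th].  The statement is
homogeneous: the points are [u / s] and [v / (t - s)], the weight of the first
one is [s / t]; this allows [s = t]. *)
Lemma strongly_extreme_average x : strongly_extreme x ->
  forall th e : R, 0 < th <= 1 -> 0 < e -> exists d, 0 < d /\
    forall t s u v, 0 < t -> th * t <= s <= t -> `|u| <= s -> `|v| <= t - s ->
      `|t *: x - (u + v)| < d * t -> `|s *: x - u| < e * s.
Proof.
move=> xse th e /andP[th0 th1] e0.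
have the0 : 0 < th * (e / 2) by rewrite mulr_gt0// divr_gt0.
have [d [d0 xd]] := strongly_extreme_modulus xse the0.
exists (Num.min d (e / 2)); split.
  by rewrite lt_min d0 divr_gt0.
move=> t s u v t0 /andP[ts st] us vs xuv.
have s0 : 0 < s by apply: lt_le_trans ts; exact: mulr_gt0.
pose z := t^-1 *: (u + v); pose a := s^-1 *: u.
have uE : u = s *: a by rewrite scalerA divff ?gt_eqF// scale1r.
have zE : u + v = t *: z by rewrite scalerA divff ?gt_eqF// scale1r.
have xz : `|x - z| < Num.min d (e / 2).
  by move: xuv; rewrite zE -scalerBr normrZ gtr0_norm// mulrC ltr_pM2r.
have [xzd xze] : `|x - z| < d /\ `|x - z| < e / 2.
  by move: xz; rewrite lt_min => /andP[].
have a1 : `|a| <= 1.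
  by rewrite normrZ gtr0_norm ?invr_gt0// ler_pdivrMl// mulr1.
have z1 : `|z| <= 1.
  rewrite normrZ gtr0_norm ?invr_gt0// ler_pdivrMl// mulr1.
  by have := ler_normD u v; lra.
clearbody a z; pose w := th *: (a - z).
have zw : `|z + w| <= 1.
  have -> : z + w = th *: a + (1 - th) *: z.
    by rewrite /w scalerBr scalerBl scale1r addrCA addrC.
  apply: le_trans (ler_normD _ _) _; rewrite !normrZ.
  rewrite !ger0_norm ?subr_ge0//; last exact: ltW.
  have th1' : 0 <= 1 - th by rewrite subr_ge0.
  have := ler_wpM2l (ltW th0) a1; have := ler_wpM2l th1' z1.
  by rewrite !mulr1; lra.
(* As the weight [s / t] of [a] in [z] is at least [th], [z - w] is still
   a convex combination of [a] and of the second point. *)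
have zw' : `|z - w| <= 1.
  rewrite -(ler_pM2l t0) mulr1 -[t]gtr0_norm// -normrZ gtr0_norm//.
  have -> : t *: (z - w) = ((1 + th) * s - th * t) *: a + (1 + th) *: v.
    have -> : t *: (z - w) = (1 + th) *: (u + v) - (th * t) *: a.
      rewrite zE /w -[- (th *: _)]scalerN opprB scalerBr scalerDr scalerBr.
      by rewrite addrA !scalerA mulrDl mul1r scalerDl (mulrC t th).
    by rewrite uE scalerDr scalerA addrAC -scalerBl.
  apply: le_trans (ler_normD _ _) _; rewrite !normrZ.
  rewrite !ger0_norm; [|lra|nra].
  have c0 : 0 <= (1 + th) * s - th * t by nra.
  have d0' : 0 <= 1 + th by lra.
  have := ler_wpM2l c0 a1; have := ler_wpM2l d0' vs.
  by rewrite mulr1; lra.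
have : `|w| < th * (e / 2).
  apply: xd.
    have -> : x + w = (x - z) + (z + w) by rewrite addrA subrK.
    by have := ler_normD (x - z) (z + w); lra.
  have -> : x - w = (x - z) + (z - w) by rewrite addrA subrK.
  by have := ler_normD (x - z) (z - w); lra.
rewrite normrZ gtr0_norm// ltr_pM2l// => az.
rewrite uE -scalerBr normrZ gtr0_norm// mulrC ltr_pM2r//.
have -> : x - a = (x - z) - (a - z) by rewrite opprB addrA subrK.
by have := ler_normB (x - z) (a - z); lra.
Qed.

End StronglyExtreme.

(** * From weak neighbourhoods to slices *)

Section WeakSlice.
Variables (R : realType) (X : normedModType R).

(** A weak neighbourhood of a strongly extreme point contains, relatively to the
unit ball, a slice around this point; [f] defines the slice. *)
Lemma slice_in_weak_nbhd x (I : finType) (h : I -> {linear X -> R^o})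
    (M d : R) : strongly_extreme x -> 0 < M ->
  (forall i v, `|h i v : R| <= M * `|v|) -> 0 < d ->
  exists (f : {linear X -> R^o}) (eta : R),
    [/\ 0 < eta, forall v, f v <= `|v| &
      forall y i, `|y| <= 1 -> d <= h i (y - x) -> f y <= f x - eta].
Proof.
move=> xse M0 hM d0.
(* The successor makes [th * #|I| < 1] and keeps [th] positive when [I] is
   empty. *)
pose th : R := (#|I|.+1%:R)^-1.
have th01 : 0 < th <= 1 by rewrite invr_gt0 ltr0Sn invf_le1 ?ltr0Sn// ler1n.
have [eta [eta0 xavg]] := strongly_extreme_average xse th01 (divr_gt0 d0 M0).
(* [K i] is the cone generated by the pairs [(y, 1)] with [y] in the unit ball
   and [d <= h i (y - x)].  Summing one element of each [K i] avoids describing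
   the convex hull of these sets. *)
pose K i (s : X) (t : R) := `|s| <= t /\ d * t <= h i (s - t *: x).
have K_ge0 i s t : K i s t -> 0 <= t by case=> + _; exact: le_trans.
pose C : set (X * R) := [set p | exists (s : I -> X) (t : I -> R),
  (forall i, K i (s i) (t i)) /\
  p = ((\sum_i t i) *: x - \sum_i s i, eta * \sum_i t i)].
have K0 i : K i 0 0 by split; rewrite ?normr0// scale0r subr0 linear0 mulr0.
have [||f [fle fC]] := @cone_separation R X C.
- split.
  + exists (fun=> 0), (fun=> 0); split => //.
    by rewrite !big1// scale0r subr0 mulr0.
  + move=> _ _ _ _ [s [t [K1 [-> ->]]]] [s' [t' [K2 [-> ->]]]].
    exists (fun i => s i + s' i), (fun i => t i + t' i); split.
      move=> i; have [n1 h1] := K1 i; have [n2 h2] := K2 i; split.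
        by apply: le_trans (ler_normD _ _) _; exact: lerD.
      by rewrite mulrDr scalerDl opprD addrACA linearD; exact: lerD.
    by rewrite !big_split/= mulrDr scalerDl opprD addrACA.
  + move=> a _ _ a0 [s [t [K1 [-> ->]]]].
    exists (fun i => a *: s i), (fun i => a * t i); split.
      move=> i; have [n1 h1] := K1 i; split.
        by rewrite normrZ ger0_norm// ler_wpM2l.
      by rewrite -scalerA -scalerBr linearZ mulrCA; exact: ler_wpM2l.
    by rewrite -mulr_sumr -scaler_sumr -scalerA -scalerBr mulrCA.
- move=> _ _ [s [t [Kst [-> ->]]]].
  have t_ge0 i : 0 <= t i by exact: K_ge0 (Kst i).
  rewrite leNgt; apply/negP => lt_eta.
  have T0 : 0 < \sum_i t i.
    by move: (le_lt_trans (normr_ge0 _) lt_eta); rewrite pmulr_rgt0.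
  (* Some cone carries at least the fraction [th] of the total weight. *)
  have [j tj] : exists j, th * \sum_i t i <= t j.
    apply: contrapT => /forallNP nj.
    have lej i : t i <= th * \sum_i t i by rewrite leNgt; apply/negP => /ltW/nj.
    have : \sum_i t i <= #|I|%:R * (th * \sum_i t i).
      apply: le_trans (ler_sum _ (fun i _ => lej i)) _.
      by rewrite sumr_const mulr_natl.
    rewrite leNgt mulrA gtr_pMl// /th ltr_pdivrMr ?ltr0Sn// mul1r.
    by rewrite ltr_nat ltnSn.
  have [sj hj] := Kst j.
  have tj0 : 0 < t j.
    by apply: lt_le_trans tj; rewrite mulr_gt0//; case/andP: th01.
  have rest : `|\sum_(i | i != j) s i| <= (\sum_i t i) - t j.
    rewrite [X in _ <= X - _](bigD1 j)//= addrAC subrr add0r.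
    apply: le_trans (ler_norm_sum _ _ _) _.
    by apply: ler_sum => i _; case: (Kst i).
  have tjT : t j <= \sum_i t i.
    by rewrite (bigD1 j)//= lerDl sumr_ge0.
  have sumE : \sum_i s i = s j + \sum_(i | i != j) s i by rewrite (bigD1 j).
  have := xavg (\sum_i t i) (t j) (s j) (\sum_(i | i != j) s i) T0.
  rewrite tj tjT -sumE => /(_ isT sj rest lt_eta).
  apply/negP; rewrite -leNgt.
  rewrite -(ler_pM2l M0) mulrA mulrCA divff ?gt_eqF// mulr1.
  apply: le_trans hj _; apply: le_trans (ler_norm _) _.
  by rewrite distrC; exact: hM.
exists f, eta; split => // y i y1 hy.
suff : eta <= f (x - y) by rewrite linearB/=; lra.
apply: fC; exists (fun j => if j == i then y else 0),
  (fun j => if j == i then 1 else 0); split.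
  move=> j; case: eqP => [->|_]; last exact: K0.
  by split => //; rewrite scale1r mulr1.
by rewrite -!big_mkcond/= !big_pred1_eq scale1r mulr1.
Qed.

End WeakSlice.

(** * Disjoint vectors in a vector lattice *)

Section LatticeVectors.
Variables (R : realType) (X : vectorLatticeType R).
Implicit Types (a b c u v w x y z : X).

Lemma vle_meetl x y : vle (vmeet x y) x.
Proof. by have := vlexI (vmeet x y) x y; rewrite vle_refl => /esym/andP[]. Qed.

Lemma vle_meetr x y : vle (vmeet x y) y.
Proof. by have := vlexI (vmeet x y) x y; rewrite vle_refl => /esym/andP[]. Qed.

Lemma vle_joinl x y : vle x (vjoin x y).
Proof. by have := vleUx x y (vjoin x y); rewrite vle_refl => /esym/andP[]. Qed.

Lemma vle_joinr x y : vle y (vjoin x y).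
Proof. by have := vleUx x y (vjoin x y); rewrite vle_refl => /esym/andP[]. Qed.

Lemma vleD x y u v : vle x y -> vle u v -> vle (x + u) (y + v).
Proof.
move=> xy uv; apply: (@vle_trans _ _ (y + u)); first exact: vleD2r.
by rewrite ![y + _]addrC; exact: vleD2r.
Qed.

Lemma vleD2rE z x y : vle (x + z) (y + z) = vle x y.
Proof.
by apply/idP/idP => [/(vleD2r (- z))|]; [rewrite !addrK|exact: vleD2r].
Qed.

Lemma modulus_le x y : vle (modulus x) y = vle x y && vle (- x) y.
Proof. exact: vleUx. Qed.

Lemma modulus_ge0 x : vle 0 (modulus x).
Proof.
have : vle 0 (modulus x + modulus x).
  by rewrite -(subrr x); apply: vleD; [exact: vle_joinl|exact: vle_joinr].
have h : (0 : R) <= 2^-1 by rewrite invr_ge0.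
move/(vleZ _ _ _ h); rewrite scaler0 -[modulus x + _]mulr2n.
by rewrite -[modulus x *+ 2]scaler_nat scalerA mulVf ?pnatr_eq0// scale1r.
Qed.

Lemma modulusN x : modulus (- x) = modulus x.
Proof.
apply: vle_anti; rewrite !modulus_le opprK.
by rewrite /modulus vle_joinl vle_joinr; have := vle_joinl (- x) x;
  have := vle_joinr (- x) x; rewrite opprK => -> ->.
Qed.

Lemma modulusD_le x y : vle (modulus (x + y)) (modulus x + modulus y).
Proof.
rewrite modulus_le opprD; apply/andP; split; apply: vleD;
  by [exact: vle_joinl|exact: vle_joinr].
Qed.

(** For disjoint [u] and [v] both sides are equal to
[modulus u + modulus v]; only this inequality is needed. *)
Lemma disjoint_modulus_le u v : disjoint_vec u v ->
  vle (modulus (u - v)) (modulus (u + v)).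
Proof.
move=> duv; set w := modulus (u + v).
(* [modulus p] lies below both [modulus q + r] and [modulus p + r], hence below
   [r + vmeet (modulus p) (modulus q) = r]. *)
have bound (p q : X) : disjoint_vec p q -> vle (modulus p) (modulus (p + q)).
  move=> dpq; set r := modulus (p + q).
  have le1 : vle (modulus p) (modulus q + r).
    by have := modulusD_le (p + q) (- q); rewrite addrK modulusN addrC.
  have le2 : vle (modulus p) (modulus p + r).
    by have := vleD (vle_refl (modulus p)) (modulus_ge0 (p + q)); rewrite addr0.
  have : vle (modulus p - r) (vmeet (modulus p) (modulus q)).
    by rewrite vlexI -![vle (_ - r) _](vleD2rE r) !subrK le1 le2.
  by rewrite dpq -(vleD2rE r) subrK add0r.
have duv' : disjoint_vec v u.
  apply: vle_anti; rewrite -duv !vlexI.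
  by rewrite vle_meetl vle_meetr vle_meetl vle_meetr.
have uw : vle (modulus u) w := bound _ _ duv.
have vw : vle (modulus v) w by rewrite /w addrC; exact: bound.
apply: (@vle_trans _ _ (modulus u + modulus v)).
  by rewrite -[modulus v]modulusN; exact: modulusD_le.
have : vle (modulus u + modulus v - w) (vmeet (modulus u) (modulus v)).
  rewrite vlexI -(vleD2rE w) -[X in _ && X](vleD2rE w) subrK.
  rewrite [X in _ && vle X _]addrC.
  by apply/andP; split; apply: vleD => //; exact: vle_refl.
by rewrite duv -(vleD2rE w) subrK add0r.
Qed.

End LatticeVectors.

(** * Points of continuity in Banach lattices *)

Section BanachLattices.
Variables (R : realType) (X : banachLatticeType R).

Lemma norm_disjointB (u v : X) : disjoint_vec u v -> `|u - v| <= `|u + v|.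
Proof. by move=> /disjoint_modulus_le; exact: vle_norm. Qed.

(** The point [x] of the unit ball is a point of continuity, with respect to the
seminorm [`|P _|] of a suitable finite rank projection. *)
Lemma lattice_projection_continuity (x : X) (e : R) : strongly_extreme x ->
  id_approx_at x -> 0 < e ->
  exists d, 0 < d /\ exists P : {linear X -> X},
    [/\ continuous P, finite_rank P &
      forall y, `|y| <= 1 -> `|P (y - x)| < d -> `|y - x| < e].
Proof.
move=> xse xap e0.
have e3 : 0 < e / 3 by rewrite divr_gt0.
have [d0 [d0_gt0 xd]] := strongly_extreme_modulus xse e3.
pose d := Num.min (d0 / 2) (e / 3).
have d_gt0 : 0 < d by rewrite lt_min e3 divr_gt0.
have [dd0 de] : d <= d0 / 2 /\ d <= e / 3.
  by rewrite /d !ge_min !lexx orbT.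
have [P [[[Pc PP] Pdis] Pfin xP]] := xap _ d_gt0.
exists d; split => //; exists P; split => // y y1 Pyx.
pose u := y - P y.
have xPy : `|x - P y| < 2 * d.
  have -> : x - P y = (x - P x) - P (y - x).
    by rewrite linearB/= opprB addrA subrK.
  by have := ler_normB (x - P x) (P (y - x)); lra.
have uy : `|P y - u| <= 1.
  have Pu : P u = 0 by rewrite /u linearB/= PP subrr.
  have := norm_disjointB (Pdis _ _ (ex_intro2 _ _ y I erefl) Pu).
  by rewrite [P y + u]addrC subrK => /le_trans; apply.
have u_lt : `|u| < e / 3.
  apply: xd.
    have -> : x + u = (x - P y) + y by rewrite /u addrA addrAC.
    by have := ler_normD (x - P y) y; lra.
  have -> : x - u = (x - P y) + (P y - u) by rewrite addrA subrK.
  by have := ler_normD (x - P y) (P y - u); lra.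
have -> : y - x = u - (x - P y) by rewrite /u opprB addrA subrK.
by have := ler_normB u (x - P y); lra.
Qed.

End BanachLattices.

(** * Denting points *)

Section Denting.
Variables (R : realType) (X : normedModType R).

(** For a finite rank operator, the seminorm [`|P _|] is controlled by finitely
many one-sided inequalities between functionals. *)
Lemma finite_rank_weak_nbhd (P : {linear X -> X}) (d : R) :
  continuous P -> finite_rank P -> 0 < d ->
  exists (I : finType) (h : I -> {linear X -> R^o}) (M rho : R),
    [/\ 0 < M, 0 < rho, forall i v, `|h i v : R| <= M * `|v| &
      forall v, (forall i, h i v < rho) -> `|P v| < d].
Proof.
move=> /continuous_bound[MP MP0 PM] [n [e Pe]] d0.
have [s [sb se]] := span_coordinates e.
have Ps v : P v = \sum_(p <- s) p.1 (P v) *: p.2.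
  by have [c ->] := Pe v; exact: se.
have [N [N0 sN]] : exists N, 0 < N /\
    forall p, p \in s -> forall v, `|p.1 v : R| <= N * `|v|.
  elim: s sb {se Ps} => [|p s IH] sb; first by exists 1.
  have [|N [N0 sN]] := IH; first by move=> q qs; apply: sb; rewrite inE qs orbT.
  have [M pM] := sb p (mem_head _ _).
  exists (Num.max N M); rewrite lt_max N0; split => // q.
  rewrite inE => /predU1P[->|qs] v.
    by apply: le_trans (pM v) _; rewrite ler_wpM2r// le_max lexx orbT.
  by apply: le_trans (sN _ qs v) _; rewrite ler_wpM2r// le_max lexx.
pose W := 1 + \sum_(p <- s) `|p.2|.
have W0 : 0 < W by rewrite ltr_pwDl// sumr_ge0.
pose c (b : bool) : R := if b then 1 else -1.
(* Each coordinate of [P v] is taken with both signs. *)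
pose g (i : 'I_(size s) * bool) : {linear X -> R^o} :=
  c i.2 \*: ((tnth (in_tuple s) i.1).1 \o P).
exists ('I_(size s) * bool)%type, g, (N * MP), (d / W); split.
- exact: mulr_gt0.
- exact: divr_gt0.
- move=> [i b] v; rewrite /g /= normrM.
  have -> : `|c b| = 1 by rewrite /c; case: b; rewrite ?normrN normr1.
  have := sN _ (mem_tnth i (in_tuple s)) (P v); rewrite mul1r => /le_trans.
  by apply; rewrite -mulrA ler_pM2l.
- move=> v hv; rewrite Ps; apply: le_lt_trans (ler_norm_sum _ _ _) _.
  apply: (@le_lt_trans _ _ (\sum_(p <- s) d / W * `|p.2|)).
    rewrite [leLHS]big_tnth [leRHS]big_tnth; apply: ler_sum => i _.
    rewrite normrZ ler_wpM2r// ler_norml; have := hv (i, true); have := hv (i, false).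
    rewrite /g /c /= scale1r scaleN1r => h1 h2.
    by apply/andP; split; [rewrite lerNl|]; exact: ltW.
  rewrite -mulr_sumr mulrAC ltr_pdivrMr// ltr_pM2l//.
  by rewrite /W ltrDr.
Qed.

(** The factor [c] is the inverse of the dual norm of [f]. *)
Lemma normalized_functional (f : {linear X -> R^o}) x :
  (forall v, f v <= `|v|) -> `|x| <= 1 -> 0 < f x ->
  exists c : R, [/\ 0 < c, dual_sphere (c \*: f) & c * f x <= 1].
Proof.
move=> fle x1 fx0; have fabs := abs_functional_le fle.
pose S := [set `|f y : R| | y in @unit_ball R X].
have Sx : S `|f x : R| by exists x.
have Sub : has_ubound S.
  by exists 1 => _ [y y1 <-]; exact: le_trans (fabs y) y1.
pose N := sup S.
have fxN : (f x : R) <= N.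
  exact: (le_trans (ler_norm (f x : R)) (ub_le_sup Sub Sx)).
have N0 : 0 < N := lt_le_trans fx0 fxN.
have Ni0 : 0 < N^-1 by rewrite invr_gt0.
exists N^-1; split => //; last by rewrite ler_pdivrMl// mulr1.
split.
  apply: (@bounded_functional_continuous R X _ N^-1) => v.
  by rewrite /= normrM gtr0_norm// ler_pM2l.
pose S' := [set `|N^-1 * f y : R| | y in @unit_ball R X].
have S'E y : `|N^-1 * f y : R| = N^-1 * `|f y : R|.
  by rewrite normrM gtr0_norm.
have S'x : S' `|N^-1 * f x : R| by exists x.
have S'1 : ubound S' 1.
  move=> _ [y y1 <-]; rewrite S'E ler_pdivrMl// mulr1.
  by apply: ub_le_sup => //; exists y.
have -> : dual_norm (N^-1 \*: f) = ereal_sup (EFin @` S').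
  by rewrite /dual_norm /S' image_comp.
rewrite ereal_sup_EFin; [|by exists 1|by exists `|N^-1 * f x : R|].
congr (_%:E); apply/eqP; rewrite eq_le; apply/andP; split.
  by apply: ge_sup => //; exists `|N^-1 * f x : R|.
rewrite -(ler_pM2l N0) mulr1; apply: ge_sup; first by exists `|f x : R|.
move=> _ [y y1 <-]; rewrite -ler_pdivrMl// -S'E.
by apply: ub_le_sup; [exists 1|exists y].
Qed.

(** A strongly extreme point at which the weak and norm topologies of the unit
ball agree is a denting point. *)
Lemma denting_of_weak_nbhd (x : X) : strongly_extreme x ->
  (forall e : R, 0 < e ->
    exists (I : finType) (h : I -> {linear X -> R^o}) (M rho : R),
      [/\ 0 < M, 0 < rho, forall i v, `|h i v : R| <= M * `|v| &
        forall y, `|y| <= 1 -> (forall i, h i (y - x) < rho) ->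
          `|y - x| < e]) ->
  denting x.
Proof.
move=> xse xw; have x1 : `|x| = 1 by case: xse.
split; first by rewrite /unit_ball/= x1.
move=> eps eps0.
pose e := Num.min (eps / 4) 1.
have e0 : 0 < e by rewrite lt_min ltr01 divr_gt0.
have [e4 e1] : e <= eps / 4 /\ e <= 1 by rewrite /e !ge_min !lexx orbT.
have [I [h [M [rho [M0 rho0 hM hx]]]]] := xw _ e0.
have [f [eta [eta0 fle fsep]]] := slice_in_weak_nbhd xse M0 hM rho0.
have far y : `|y| <= 1 -> e <= `|y - x| -> f y <= f x - eta.
  move=> y1 yx; have [i hi] : exists i, rho <= h i (y - x).
    apply: contrapT => /forallNP nh.
    suff : `|y - x| < e by rewrite ltNge yx.
    by apply: hx => // i; rewrite ltNge; apply/negP; exact: nh.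
  exact: fsep hi.
(* The point [- x] is at distance [2] from [x], hence outside the neighbourhood
   since [e <= 1]; this makes [f] nonzero. *)
have fx0 : 0 < f x.
  have : f (- x) <= f x - eta.
    apply: far; rewrite ?normrN ?x1// -opprD normrN -mulr2n normrMn x1.
    by apply: le_trans e1 _; rewrite ler1n.
  by rewrite linearN/=; lra.
have [|c [c0 fS cx]] := normalized_functional fle _ fx0; first by rewrite x1.
exists (c \*: f), (1 - c * (f x - eta / 2)).
have ceta : 0 < c * eta by exact: mulr_gt0.
split => //.
- by rewrite subr_gt0; apply: lt_le_trans cx; rewrite ltr_pM2l//; lra.
- split; first by rewrite /unit_ball/= x1.
  by rewrite /= opprB addrCA subrr addr0 ltr_pM2l//; lra.
apply: (@le_lt_trans _ _ (eps / 2)%:E); last by rewrite lte_fin; lra.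
have near_x y : slice (c \*: f) (1 - c * (f x - eta / 2)) y -> `|y - x| < e.
  move=> [y1]; rewrite /= opprB addrCA subrr addr0 ltr_pM2l// => fy.
  by rewrite ltNge; apply/negP => /(far _ y1); lra.
apply: ge_ereal_sup => _ [[y z] [/near_x/= yx /near_x/= zx] <-].
rewrite lee_fin/=; have -> : y - z = (y - x) - (z - x).
  by rewrite opprB addrA subrK.
by have := ler_normB (y - x) (z - x); lra.
Qed.

End Denting.

Theorem proposition4p2 (R : realType) (X : banachLatticeType R) (x : X)
    (hx : unit_ball x) (hse : strongly_extreme x) (hap : id_approx_at x) :
  denting x.
Proof.
apply: denting_of_weak_nbhd => // e e0.
have [d [d0 [P [Pc Pfin Pd]]]] := lattice_projection_continuity hse hap e0.
have [I [h [M [rho [M0 rho0 hM hd]]]]] := finite_rank_weak_nbhd Pc Pfin d0.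
by exists I, h, M, rho; split => // y y1 hy; apply: Pd => //; exact: hd.
Qed.
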